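(* Let $1\le r\le n$ and let $\mathcal{C}=\{X\in\mathbb{R}^{n\times n}:\operatorname{rank}(X)=r,\ X\succeq0,\ X^2=X\}$, the space of rank-$r$ (orthogonal) projection matrices. Then, with respect to the nuclear norm $\|\cdot\|=\|\cdot\|_{\mathrm{nuc}}$ and its dual, the spectral norm $\|\cdot\|^*=\|\cdot\|_{\mathrm{sp}}$, $\mathcal{C}$ has local concavity coefficients $\gamma_X(\mathcal{C})\le2$ for all $X\in\mathcal{C}$.
   Context: $X\succeq0$ means symmetric positive semidefinite. $\|X\|_{\mathrm{nuc}}$ is the sum of the singular values of $X$, $\|X\|_{\mathrm{sp}}$ the largest singular value, $\|X\|_F$ the Frobenius norm and $\langle\cdot,\cdot\rangle$ the trace inner product. $P_{\mathcal{C}}(Z)\in\arg\min_{X\in\mathcal{C}}\|X-Z\|_F$; if the minimizer is non-unique, $P_{\mathcal{C}}(Z)$ denotes any minimizer, claims involving it are to hold for every choice, and ''$P_{\mathcal{C}}(Z)=X$'' means that $X$ is a minimizer. Degenerate points: $\mathcal{C}_{\mathrm{dgn}}=\{X\in\mathcal{C}:P_{\mathcal{C}}\text{ is not continuous over any neighborhood of }X\}$. Local concavity coefficients: $\gamma_X(\mathcal{C})=\infty$ if $X\in\mathcal{C}_{\mathrm{dgn}}$, and for $X\in\mathcal{C}\setminus\mathcal{C}_{\mathrm{dgn}}$, $\gamma_X(\mathcal{C})$ is the smallest $\gamma\in[0,\infty]$ such that $\langle Y-X,Z-X\rangle\le\gamma\|Z-X\|^*\|Y-X\|_F^2$ for all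 $Y\in\mathcal{C}$ and all $Z\in\mathbb{R}^{n\times n}$ with $P_{\mathcal{C}}(Z)=X$. *)

(* Defs.v *)
From HB Require Import structures.
From mathcomp Require Import all_boot all_order all_algebra.
From mathcomp Require Import all_classical all_reals all_analysis.
From mathcomp Require Import polyrcf.

Set Implicit Arguments.
Unset Strict Implicit.
Unset Printing Implicit Defensive.

Import Order.TTheory GRing.Theory Num.Theory.
Import numFieldNormedType.Exports.

Local Open Scope classical_set_scope.
Local Open Scope ring_scope.

Section MatrixNorms.
Context {R : realType} {n : nat}.
Implicit Types A B X Y Z : 'M[R]_n.

Definition mxinner A B : R := \tr (A^T *m B).

Definition frob_norm A : R := Num.sqrt (mxinner A A).

(* Real roots of the characteristic polynomial, each one repeated according to
   its algebraic multiplicity. *)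
Definition real_eigenvalues A : seq R :=
  let p := char_poly A in flatten [seq nseq (mup x p) x | x <- rootsR p].

Definition singular_values A : seq R :=
  [seq Num.sqrt x | x <- real_eigenvalues (A^T *m A)].

Definition nuc_norm A : R := \sum_(s <- singular_values A) s.

(* Singular values are nonnegative, so starting the maximum at 0 is harmless. *)
Definition sp_norm A : R := \big[Num.max/0]_(s <- singular_values A) s.

Definition dual_norm (N : 'M[R]_n -> R) Z : R :=
  sup [set mxinner X Z | X in [set X | N X <= 1]].

Definition psdmx A : Prop :=
  A^T = A /\ forall v : 'cV[R]_n, 0 <= (v^T *m A *m v) 0 0.

Definition rank_projections (r : nat) : set 'M[R]_n :=
  [set X | [/\ \rank X = r, psdmx X & X *m X = X]].

End MatrixNorms.

Section LocalConcavity.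
Context {R : realType} {n : nat}.
Implicit Types (C : set 'M[R]_n) (X Y Z : 'M[R]_n).

Definition is_nearest C Z X : Prop :=
  C X /\ forall Y, C Y -> frob_norm (X - Z) <= frob_norm (Y - Z).

Definition projection_map C (P : 'M[R]_n -> 'M[R]_n) : Prop :=
  forall Z, is_nearest C Z (P Z).

(* The topology on matrices is the entrywise one, which is that of any norm. *)
Definition degenerate C (P : 'M[R]_n -> 'M[R]_n) : set 'M[R]_n :=
  [set X | C X /\
     ~ exists U : set 'M[R]_n, nbhs X U /\ {within U, continuous P}].

Definition concavity_bound (N : 'M[R]_n -> R) C X : set (\bar R) :=
  [set g | (0 <= g)%E /\
     forall Y Z, C Y -> is_nearest C Z X ->
       ((mxinner (Y - X) (Z - X))%:E <=
         g * (dual_norm N (Z - X) * frob_norm (Y - X) ^+ 2)%:E)%E].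

(* When N is a norm, concavity_bound N C X contains +oo and is closed (a zero
   factor on the right forces a zero inner product on the left), so that the
   infimum is its least element. The map P, a choice of nearest points, only
   matters for degeneracy: the inequalities range over all Z admitting X as a
   nearest point, whether or not P Z is X. *)
Definition local_concavity (N : 'M[R]_n -> R) C (P : 'M[R]_n -> 'M[R]_n) X
    : \bar R :=
  if `[< degenerate C P X >] then +oo%E else ereal_inf (concavity_bound N C X).

End LocalConcavity.

(* Main.v *)
Require Import Defs.
From mathcomp Require Import all_boot all_order all_algebra.
From mathcomp Require Import all_classical all_reals all_analysis.
From mathcomp Require Import ring lra.
From mathcomp Require Import polyrcf.
From mathcomp Require complex.

(* Duality: if the columns u_j of U^T are an orthonormal eigenbasis of X^T X with
   eigenvalues d_j, then <X, Z> = sum_j <X u_j, Z u_j>, where |X u_j| = sqrt d_j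
   and |Z u_j| <= |Z|_sp; equality is attained by a rank-one matrix built from a
   top singular pair of Z.

   Concavity: all elements of C have the same Frobenius norm, so X is nearest to
   Z iff it maximizes <Y, Z> over C. Rotating a vector of range X towards ker X
   shows that X (Z + Z^T) (1 - X) = 0, so only the two diagonal blocks of Y - X
   contribute to <Y - X, Z - X>; hence this is at most |Z - X|_sp |Y - X|_F^2.

   Nondegeneracy: near X the same inequality, with the Frobenius norm in place of
   the spectral norm, shows that nearest points are Lipschitz in Z. *)

Set Implicit Arguments.
Unset Strict Implicit.
Unset Printing Implicit Defensive.

Import Order.TTheory GRing.Theory Num.Theory.
Import numFieldNormedType.Exports.

Local Open Scope ring_scope.

(** * Real eigenvalues of symmetric matrices, and the trace of an idempotent *)

Section SymmetricEigenvalue.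
Import complex.

(** Over the complex numbers the matrix is Hermitian, hence unitarily diagonalizable with real
    diagonal. A real root of the complexified characteristic polynomial is already a root of the
    original one. *)
Lemma symmetric_eigenvalue (R : rcfType) (n : nat) (A : 'M[R]_n.+1) :
  A^T = A -> exists a, eigenvalue A a.
Proof.
move=> symA; pose B := map_mx (real_complex R) A.
have hermB : B \is hermsymmx.
  apply: spectral.realsym_hermsym.
    by apply/is_hermitianmxP/matrixP => i j; rewrite expr0 scale1r !mxE -[in LHS]symA mxE.
  by apply/mxOverP => i j; rewrite mxE complex_real.
have /mxOverP realD := spectral.hermitian_spectral_diag_real hermB.
have /spectral.hermitian_normalmx /spectral.orthomx_spectralP := hermB.
have := spectral.spectral_unit B.
move: (spectral.spectralmx B) (spectral.spectral_diag B) realD => P D realD Pu defB.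
exists (complex.Re (D 0 0)).
rewrite eigenvalue_root_char -(fmorph_root (real_complex R)) map_char_poly.
rewrite [X in root _ X](RRe_real (realD 0 0)).
(* From [P B = diag(D) P], the first row of [P] is a left eigenvector; it is nonzero because [P] is
   invertible. *)
rewrite -eigenvalue_root_char; apply/eigenvalueP; exists (row 0 P).
  rewrite -row_mul -/B defB !mulmxA mulmxV // mul1mx.
  by apply/rowP => j; rewrite mul_diag_mx !mxE.
apply/negP => /eqP P0; have : row 0 P *m invmx P = 0 by rewrite P0 mul0mx.
rewrite -row_mul mulmxV // => /rowP/(_ 0)/eqP.
by rewrite !mxE eqxx oner_eq0.
Qed.

End SymmetricEigenvalue.

(** Write [X = L R] with [L] of full column rank and [R] of full row rank. Cancelling them in
    [L R L R = L R] leaves [R L = 1], an identity of size rank X, and [L R] and [R L] have the same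
    trace. *)
Lemma mxtrace_idempotent (F : fieldType) (n : nat) (X : 'M[F]_n) :
  X *m X = X -> \tr X = (\rank X)%:R.
Proof.
move=> idX; move: (mulmx_base X) (row_base_free X) (col_base_full X).
move: (col_base X) (row_base X) => C B defX freeB fullC.
have BC : B *m C = 1%:M.
  apply: (row_free_inj freeB); apply: (row_full_inj fullC).
  by rewrite /= mul1mx -!mulmxA defX mulmxA defX idX.
by rewrite -[in LHS]defX mxtrace_mulC BC mxtrace1.
Qed.

(** * The Frobenius inner product *)

Section FrobeniusProduct.
Context {R : realType}.

(** Extends [mxinner] to rectangular matrices, so that column vectors and square matrices share one
    inner product. *)
Definition fdot m n (A B : 'M[R]_(m, n)) : R := \tr (A^T *m B).

Lemma fdotE m n (A B : 'M[R]_(m, n)) : fdot A B = \sum_i \sum_j A i j * B i j.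
Proof.
rewrite exchange_big; apply: eq_bigr => j _; rewrite mxE.
by apply: eq_bigr => i _; rewrite !mxE.
Qed.

Lemma fdotC m n (A B : 'M[R]_(m, n)) : fdot A B = fdot B A.
Proof. by rewrite /fdot -[RHS]mxtrace_tr trmx_mul trmxK. Qed.

Lemma fdotDr m n (A B C : 'M[R]_(m, n)) : fdot A (B + C) = fdot A B + fdot A C.
Proof. by rewrite /fdot mulmxDr mxtraceD. Qed.

Lemma fdotDl m n (A B C : 'M[R]_(m, n)) : fdot (A + B) C = fdot A C + fdot B C.
Proof. by rewrite !(fdotC _ C) fdotDr. Qed.

Lemma fdotNr m n (A B : 'M[R]_(m, n)) : fdot A (- B) = - fdot A B.
Proof. by rewrite /fdot mulmxN raddfN. Qed.

Lemma fdotNl m n (A B : 'M[R]_(m, n)) : fdot (- A) B = - fdot A B.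
Proof. by rewrite !(fdotC _ B) fdotNr. Qed.

Lemma fdotZr m n a (A B : 'M[R]_(m, n)) : fdot A (a *: B) = a * fdot A B.
Proof. by rewrite /fdot -scalemxAr mxtraceZ. Qed.

Lemma fdotZl m n a (A B : 'M[R]_(m, n)) : fdot (a *: A) B = a * fdot A B.
Proof. by rewrite !(fdotC _ B) fdotZr. Qed.

Definition fdot_linE := (fdotDl, fdotDr, fdotNl, fdotNr, fdotZl, fdotZr).

Lemma fdot_ge0 m n (A : 'M[R]_(m, n)) : 0 <= fdot A A.
Proof.
by rewrite fdotE; do 2![apply: sumr_ge0 => ? _]; rewrite -expr2 sqr_ge0.
Qed.

Lemma sqr_entry_le m n (A : 'M[R]_(m, n)) i j : A i j ^+ 2 <= fdot A A.
Proof.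
rewrite fdotE (bigD1 i) //= (bigD1 j) //= -expr2 -addrA lerDl addr_ge0 //.
  by apply: sumr_ge0 => ? _; rewrite -expr2 sqr_ge0.
by do 2![apply: sumr_ge0 => ? _]; rewrite -expr2 sqr_ge0.
Qed.

Lemma fdot_eq0 m n (A : 'M[R]_(m, n)) : fdot A A = 0 -> A = 0.
Proof.
move=> A0; apply/matrixP => i j; rewrite mxE; apply/eqP.
by rewrite -sqrf_eq0 -(@le_anti _ _ (A i j ^+ 2) 0) ?sqr_ge0 ?andbT -?A0 ?sqr_entry_le.
Qed.

Lemma fdot_CauchySchwarz m n (A B : 'M[R]_(m, n)) :
  fdot A B ^+ 2 <= fdot A A * fdot B B.
Proof.
have [B0|B0] := eqVneq (fdot B B) 0.
  by rewrite B0 mulr0 (fdot_eq0 B0) /fdot mulmx0 raddf0 expr0n.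
have Bpos : 0 < fdot B B by rewrite lt_def B0 fdot_ge0.
have := fdot_ge0 (fdot B B *: A - fdot A B *: B).
rewrite !fdot_linE (fdotC B A) => h.
rewrite -(ler_pM2l Bpos); nra.
Qed.

Lemma fdot_colE m n (A B : 'M[R]_(m, n)) :
  fdot A B = \sum_j fdot (col j A) (col j B).
Proof.
rewrite fdotE exchange_big; apply: eq_bigr => j _; rewrite fdotE.
by apply: eq_bigr => i _; rewrite big_ord1 !mxE.
Qed.

Lemma fdot_mull m n p (A : 'M[R]_(m, n)) (B : 'M[R]_(n, p)) (D : 'M[R]_(m, p)) :
  fdot (A *m B) D = fdot B (A^T *m D).
Proof. by rewrite /fdot trmx_mul mulmxA. Qed.

Lemma fdot_mulr m n p (A : 'M[R]_(m, n)) (B : 'M[R]_(n, p)) (D : 'M[R]_(m, p)) :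
  fdot (A *m B) D = fdot A (D *m B^T).
Proof. by rewrite /fdot trmx_mul -mulmxA mxtrace_mulC mulmxA. Qed.

End FrobeniusProduct.

(** * The real spectral theorem *)

Lemma orthogonal_with_first_row (R : realType) (n : nat) (v : 'rV[R]_n.+1) :
  v *m v^T = 1%:M -> exists2 H : 'M[R]_n.+1, H *m H^T = 1%:M & row 0 H = v.
Proof.
move=> v1; pose e : 'rV[R]_n.+1 := delta_mx 0 0.
have e1 : e *m e^T = 1%:M.
  by rewrite trmx_delta mul_delta_mx; apply/matrixP => i j; rewrite !mxE !ord1.
have ve : v *m e^T = (v 0 0)%:M.
  rewrite trmx_delta -colE; apply/matrixP => i j; rewrite !ord1 !mxE eqxx.
  by rewrite mulr1n.
have ev : e *m v^T = (v 0 0)%:M by rewrite -[LHS]trmxK trmx_mul trmxK ve tr_scalar_mx.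
have [w0|w0] := eqVneq (v 0 0) 1.
  exists 1%:M; first by rewrite trmx1 mulmx1.
  suff we : v - e = 0 by rewrite rowE mulmx1; apply/esym/subr0_eq.
  have : (v - e) *m (v - e)^T = 0.
    rewrite raddfB /= mulmxBl !mulmxBr v1 e1 ve ev w0; exact: subrr.
  by move=> we; apply: fdot_eq0; rewrite /fdot mxtrace_mulC we raddf0.
(* Householder reflection exchanging [e] and [v]: it is [1 - 2 w^T w / |w|^2], and
   [|w|^2 = 2 (1 - v 0 0)] turns the factor [2 / |w|^2] into [c]. The case [v = e], where [w]
   vanishes, is settled above. *)
have [w wE] : exists w, w = v - e by eexists.
pose c := (1 - v 0 0)^-1.
have cK : c * (1 - v 0 0) = 1 by rewrite mulVf // subr_eq0 eq_sym.
have ww : w *m w^T = (2 * (1 - v 0 0))%:M.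
  rewrite wE raddfB /= mulmxBl !mulmxBr v1 e1 ve ev -!raddfB /=.
  by congr (_%:M); ring.
have ew : e *m w^T = (- (1 - v 0 0))%:M.
  by rewrite wE raddfB /= mulmxBr ev e1 -raddfB opprB.
pose H := 1%:M - c *: (w^T *m w).
have HT : H^T = H by rewrite /H raddfB /= trmx1 linearZ /= trmx_mul trmxK.
exists H.
  rewrite HT /H mulmxBl mul1mx mulmxBr mulmx1 -scalemxAl -scalemxAr.
  rewrite !mulmxA -(mulmxA w^T) ww mul_mx_scalar -scalemxAl !scalerA.
  rewrite (_ : c * (c * _) = c * 2); last by rewrite -[RHS]mulr1 -[X in _ = _ * X]cK; ring.
  by apply/matrixP => i j; rewrite !mxE; ring.
rewrite rowE -/e /H mulmxBr mulmx1 -scalemxAr mulmxA ew mul_scalar_mx scalerA.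
by rewrite mulrN cK scaleN1r opprK wE addrC subrK.
Qed.


(** Deflation: conjugating by an orthogonal matrix whose first row is a unit eigenvector splits off
    a block of size 1, and symmetry clears the rest of the first column. Induction diagonalizes the
    remaining block. *)
Theorem symmetric_orthogonally_diagonalizable (R : realType) (n : nat)
    (A : 'M[R]_n) :
  A^T = A ->
  exists (U : 'M[R]_n) (d : 'rV[R]_n),
    U *m U^T = 1%:M /\ A = U^T *m diag_mx d *m U.
Proof.
elim: n => [|n IHn] in A *.
  by exists 0, 0; split; apply/matrixP => [[]].
move=> symA; have [a /eigenvalueP[v vA v0]] := symmetric_eigenvalue symA.
have vv0 : 0 < fdot v v.
  by rewrite lt_def fdot_ge0 andbT; apply: contra_neq v0; apply: fdot_eq0.
pose u := (Num.sqrt (fdot v v))^-1 *: v.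
have uA : u *m A = a *: u by rewrite -scalemxAl vA !scalerA mulrC.
have uu : u *m u^T = 1%:M.
  rewrite [LHS]mx11_scalar -trace_mx11 mxtrace_mulC -/(fdot u u).
  rewrite fdotZl fdotZr mulrA -invfM -expr2 sqr_sqrtr ?ltW // mulVf //.
  by rewrite gt_eqF.
have [H HH rowH] := orthogonal_with_first_row uu.
have H'H : H^T *m H = 1%:M by apply: mulmx1C.
pose B : 'M[R]_(1 + n) := H *m A *m H^T.
have symB : B^T = B by rewrite /B !trmx_mul trmxK symA mulmxA.
have rowB : row 0 B = a *: delta_mx 0 0.
  by rewrite /B !row_mul rowH uA -scalemxAl -rowH -row_mul HH rowE mulmx1.
have B_ul : ulsubmx B = a%:M.
  apply/matrixP => i j; rewrite !ord1 !mxE lshift0.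
  by have /rowP/(_ 0) := rowB; rewrite !mxE eqxx mulr1 mulr1n.
have B_ur : ursubmx B = 0.
  apply/matrixP => i j; rewrite !ord1 !mxE lshift0.
  by have /rowP/(_ (rshift 1 j)) := rowB; rewrite !mxE /= mulr0.
have B_dl : dlsubmx B = 0 by rewrite -symB -trmx_ursub B_ur trmx0.
have [|U [d [UU defB]]] := IHn (drsubmx B); first by rewrite trmx_drsub symB.
pose V : 'M[R]_n.+1 := block_mx (1%:M : 'M[R]_1) 0 0 U.
have VV : V *m V^T = 1%:M.
  rewrite /V (@tr_block_mx _ 1 n 1 n) (@mulmx_block _ 1 n 1 n 1 n).
  rewrite trmx1 !trmx0 !(mulmx0, mul0mx, mulmx1, addr0, add0r) UU.
  by rewrite -scalar_mx_block.
have defBV : B = V^T *m diag_mx (row_mx (a%:M : 'rV[R]_1) d : 'rV[R]_(1 + n)) *m V.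
  rewrite -[LHS]submxK B_ul B_ur B_dl defB /V diag_mx_row.
  rewrite (@tr_block_mx _ 1 n 1 n) !(@mulmx_block _ 1 n 1 n 1 n).
  rewrite trmx1 !trmx0 !(mulmx0, mul0mx, mulmx1, mul1mx, addr0, add0r).
  by congr block_mx; apply/matrixP => i j; rewrite !ord1 !mxE.
exists (V *m H), (row_mx (a%:M : 'rV[R]_1) d : 'rV[R]_(1 + n)); split.
  by rewrite trmx_mul mulmxA -(mulmxA V) HH mulmx1.
have -> : A = H^T *m B *m H.
  by rewrite /B !mulmxA H'H mul1mx -mulmxA H'H mulmx1.
by rewrite defBV trmx_mul !mulmxA.
Qed.

Lemma count_flatten_nseq (T : eqType) (f : T -> nat) (s : seq T) (x : T) :
  uniq s ->
  count_mem x (flatten [seq nseq (f y) y | y <- s]) = ((x \in s) * f x)%N.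
Proof.
elim: s => //= y s IHs /andP[ys us]; rewrite count_cat IHs // count_nseq /= inE.
by have [->|] := eqVneq x y; rewrite ?(negPf ys) ?mul1n ?addn0.
Qed.

(** * Singular values, and duality of the nuclear and spectral norms *)

Section SingularValues.
Context {R : realType} {n : nat}.
Implicit Types (A X Z U : 'M[R]_n) (d : 'rV[R]_n).

(** The characteristic polynomial is the product of the ['X - d_j], so the multiplicity of each root
    is its number of occurrences in [d]. *)
Lemma perm_real_eigenvalues A U d :
  U *m U^T = 1%:M -> A = U^T *m diag_mx d *m U ->
  perm_eq (real_eigenvalues A) [seq d 0 j | j : 'I_n].
Proof.
move=> UU defA.
have charA : char_poly A = \prod_(x <- [seq d 0 j | j : 'I_n]) ('X - x%:P).
  transitivity (char_poly (diag_mx d)).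
    rewrite /char_poly; pose V := map_mx polyC U.
    have VV : V^T *m V = 1%:M.
      by rewrite /V map_trmx -map_mxM (mulmx1C UU) map_mx1.
    have -> : char_poly_mx A = V^T *m char_poly_mx (diag_mx d) *m V.
      rewrite /char_poly_mx mulmxBr mulmxBl mul_mx_scalar -scalemxAl VV.
      by rewrite scalemx1 defA !map_mxM /V map_trmx.
    by rewrite !det_mulmx mulrAC -det_mulmx VV det1 mul1r.
  rewrite char_poly_trig ?diag_mx_is_trig // big_map big_enum /=.
  by apply: eq_bigr => j _; rewrite !mxE eqxx mulr1n.
have charA0 : char_poly A != 0 by rewrite monic_neq0 ?char_poly_monic.
apply/allP => x _ /=; rewrite /real_eigenvalues count_flatten_nseq ?uniq_roots //.
have := roots_on_rootsR charA0 x; rewrite /= => <-.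
rewrite -mu_prod_XsubC -charA.
by have [|/mupNroot->] := boolP (root (char_poly A) x); rewrite ?mul1n ?muln0.
Qed.

Lemma gram_diagonalization Z :
  exists U d, U *m U^T = 1%:M /\ Z^T *m Z = U^T *m diag_mx d *m U.
Proof.
by apply: symmetric_orthogonally_diagonalizable; rewrite trmx_mul trmxK.
Qed.

Lemma nuc_normE Z U d :
  U *m U^T = 1%:M -> Z^T *m Z = U^T *m diag_mx d *m U ->
  nuc_norm Z = \sum_j Num.sqrt (d 0 j).
Proof.
move=> UU ZZ; rewrite /nuc_norm /singular_values big_map.
by rewrite (perm_big _ (perm_real_eigenvalues UU ZZ)) big_map big_enum.
Qed.

Lemma sp_normE Z U d :
  U *m U^T = 1%:M -> Z^T *m Z = U^T *m diag_mx d *m U ->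
  sp_norm Z = \big[Num.max/0]_j Num.sqrt (d 0 j).
Proof.
move=> UU ZZ; rewrite /sp_norm /singular_values big_map.
by rewrite (perm_big _ (perm_real_eigenvalues UU ZZ)) big_map big_enum.
Qed.

Lemma fdot_singular_vector Z U d j :
  U *m U^T = 1%:M -> Z^T *m Z = U^T *m diag_mx d *m U ->
  fdot (Z *m col j U^T) (Z *m col j U^T) = d 0 j.
Proof.
move=> UU ZZ; rewrite fdot_mull mulmxA ZZ /fdot tr_col trmxK.
have -> : U^T *m diag_mx d *m U *m col j U^T = col j (U^T *m diag_mx d).
  by rewrite (colE _ U^T) mulmxA -colE -!mulmxA UU mulmx1.
have -> : \tr (row j U *m col j (U^T *m diag_mx d)) = (U *m (U^T *m diag_mx d)) j j.
  by rewrite trace_mx11 !mxE; apply: eq_bigr => k _; rewrite !mxE.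
by rewrite mulmxA UU mul1mx mxE eqxx mulr1n.
Qed.

Lemma gram_diagonal_ge0 Z U d j :
  U *m U^T = 1%:M -> Z^T *m Z = U^T *m diag_mx d *m U -> 0 <= d 0 j.
Proof. by move=> UU ZZ; rewrite -(fdot_singular_vector j UU ZZ) fdot_ge0. Qed.

Lemma sp_norm_ge0 Z : 0 <= sp_norm Z.
Proof.
have [U [d [UU ZZ]]] := gram_diagonalization Z.
rewrite (sp_normE UU ZZ); elim/big_rec: _ => // j x _ x0.
by rewrite le_max x0 orbT.
Qed.

(** In the orthonormal coordinates [U v] the left side is the sum of the [d_j (U v)_j^2], and each
    [d_j] is at most the square of the largest singular value. *)
Lemma fdot_mul_le_sp_norm Z (v : 'cV[R]_n) :
  fdot (Z *m v) (Z *m v) <= sp_norm Z ^+ 2 * fdot v v.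
Proof.
have [U [d [UU ZZ]]] := gram_diagonalization Z.
have -> : fdot v v = fdot (U *m v) (U *m v).
  by rewrite fdot_mull mulmxA (mulmx1C UU) mul1mx.
have -> : fdot (Z *m v) (Z *m v) = fdot (U *m v) (diag_mx d *m (U *m v)).
  by rewrite !fdot_mull !mulmxA ZZ.
rewrite !fdotE mulr_sumr; apply: ler_sum => j _; rewrite !big_ord1.
rewrite mul_diag_mx [X in _ * X <= _]mxE mulrCA -!expr2 ler_wpM2r ?sqr_ge0 //.
rewrite -(sqr_sqrtr (gram_diagonal_ge0 j UU ZZ)) lerXn2r ?nnegrE ?sqrtr_ge0 ?sp_norm_ge0 //.
by rewrite (sp_normE UU ZZ) (bigD1 j) //= le_max lexx.
Qed.

Lemma quadratic_form_le_sp_norm Z (v : 'cV[R]_n) :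
  `|fdot v (Z *m v)| <= sp_norm Z * fdot v v.
Proof.
rewrite -(@ler_pXn2r _ 2) ?nnegrE ?mulr_ge0 ?sp_norm_ge0 ?fdot_ge0 //.
rewrite real_normK ?num_real // (le_trans (fdot_CauchySchwarz _ _)) //.
rewrite exprMn [X in _ <= _ * X]expr2 mulrA [leLHS]mulrC ler_wpM2r ?fdot_ge0 //.
exact: fdot_mul_le_sp_norm.
Qed.

Lemma fdot_le_nuc_sp X Z : fdot X Z <= nuc_norm X * sp_norm Z.
Proof.
have [U [d [UU XX]]] := gram_diagonalization X.
have -> : fdot X Z = fdot (X *m U^T) (Z *m U^T).
  by rewrite fdot_mulr trmxK -mulmxA (mulmx1C UU) mulmx1.
rewrite fdot_colE (nuc_normE UU XX) mulr_suml; apply: ler_sum => j _.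
rewrite !colE -!mulmxA -!colE.
have uu : fdot (col j U^T) (col j U^T) = 1.
  rewrite /fdot tr_col trmxK trace_mx11.
  transitivity ((U *m U^T) j j); last by rewrite UU mxE eqxx.
  by rewrite !mxE; apply: eq_bigr => k _; rewrite !mxE.
apply: le_trans (ler_norm _) _.
rewrite -(@ler_pXn2r _ 2) ?nnegrE ?mulr_ge0 ?sp_norm_ge0 ?sqrtr_ge0 //.
rewrite real_normK ?num_real // (le_trans (fdot_CauchySchwarz _ _)) //.
rewrite (fdot_singular_vector j UU XX) exprMn sqr_sqrtr ?(gram_diagonal_ge0 j UU XX) //.
rewrite ler_wpM2l ?(gram_diagonal_ge0 j UU XX) //.
by rewrite (le_trans (fdot_mul_le_sp_norm _ _)) // uu mulr1.
Qed.

Lemma sp_norm_attained Z : exists2 X, nuc_norm X <= 1 & fdot X Z = sp_norm Z.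
Proof.
have [U [d [UU ZZ]]] := gram_diagonalization Z.
(* The zero case is separate because the witness below divides by the norm. *)
have [Z0|Z0] := eqVneq (sp_norm Z) 0.
  exists 0; last by rewrite Z0 /fdot trmx0 mul0mx raddf0.
  rewrite (@nuc_normE _ U 0) //; last by rewrite trmx0 (linear0 diag_mx) !(mulmx0, mul0mx).
  by rewrite big1 // => k _; rewrite mxE sqrtr0.
have [j Zj] : exists j, sp_norm Z = Num.sqrt (d 0 j).
  (* A maximum started at 0 is either this default or one of the singular values. *)
  suff [/eqP|//] : sp_norm Z = 0 \/ exists j, sp_norm Z = Num.sqrt (d 0 j).
    by rewrite (negPf Z0).
  rewrite (sp_normE UU ZZ); elim/big_rec: _ => [|j x _ IHx]; first by left.
  by case: (leP (Num.sqrt (d 0 j)) x) => _ //; right; exists j.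
pose u := col j U^T; pose w := (sp_norm Z)^-1 *: (Z *m u).
have zz : fdot (Z *m u) (Z *m u) = sp_norm Z ^+ 2.
  rewrite (fdot_singular_vector j UU ZZ) Zj sqr_sqrtr //.
  exact: gram_diagonal_ge0 j UU ZZ.
have ww : w^T *m w = 1%:M.
  rewrite [LHS]mx11_scalar -trace_mx11 -/(fdot w w).
  by rewrite fdotZl fdotZr zz expr2 mulKf // mulVf.
exists (w *m u^T); last first.
  by rewrite fdot_mulr trmxK fdotZl zz expr2 mulKf.
(* For [X = w u^T] with [w] a unit vector, [X^T X = u u^T] is diagonal in the same basis [U], with a
   single eigenvalue 1 at position [j]. *)
rewrite (@nuc_normE _ U (delta_mx 0 j)) //.
  rewrite (bigD1 j) //= big1 => [|k kj]; rewrite mxE ?eqxx ?sqrtr1 ?addr0 //=.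
  by rewrite (negPf kj) sqrtr0.
rewrite trmx_mul trmxK mulmxA -(mulmxA u) ww mulmx1 /u tr_col trmxK.
rewrite colE rowE !mulmxA; congr (_ *m _); rewrite -mulmxA mul_delta_mx.
congr (_ *m _); apply/matrixP => k l; rewrite !mxE eqxx /=.
by case: eqVneq => [->|_] /=; rewrite ?mul0rn // eq_sym.
Qed.

Lemma dual_nuc_norm Z : dual_norm nuc_norm Z = sp_norm Z.
Proof.
have ub X : nuc_norm X <= 1 -> fdot X Z <= sp_norm Z.
  move=> X1; rewrite (le_trans (fdot_le_nuc_sp _ _)) //.
  by rewrite ler_piMl ?sp_norm_ge0.
have [X X1 XZ] := sp_norm_attained Z.
apply/eqP; rewrite eq_le; apply/andP; split.
  apply: sup_le_ub; first by exists (fdot X Z); exists X.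
  by move=> _ [Y Y1 <-]; apply: ub.
rewrite -XZ; apply: ub_le_sup; last by exists X.
by exists (sp_norm Z) => _ [Y Y1 <-]; apply: ub.
Qed.

End SingularValues.

(** * Rank-r projections and their nearest-point property *)

Section RankProjections.
Context {R : realType} {n : nat}.
Implicit Types (W X Y Z : 'M[R]_n) (u v : 'cV[R]_n).

Lemma mxinnerE X Y : mxinner X Y = fdot X Y.
Proof. by []. Qed.

Lemma mul_tr_colE u v : u^T *m v = (fdot u v)%:M.
Proof. by rewrite [LHS]mx11_scalar -trace_mx11. Qed.

(** The rank is read off from the trace, and [v^T X v = |X v|^2] gives semidefiniteness; membership
    thus reduces to polynomial identities and a trace. *)
Lemma mem_rank_projections r X :
  X^T = X -> X *m X = X -> \tr X = r%:R -> rank_projections r X.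
Proof.
move=> symX idX trX; split=> //.
  by apply/eqP; rewrite -(eqr_nat R) -mxtrace_idempotent // trX.
split=> // v; rewrite -idX -{1}symX -trace_mx11.
by rewrite -!mulmxA mulmxA -trmx_mul; apply: fdot_ge0.
Qed.

Lemma rank_projection_trace r X : rank_projections r X -> \tr X = r%:R.
Proof. by case=> rX _ /mxtrace_idempotent ->; rewrite rX. Qed.

Lemma rank_projection_fdot r X : rank_projections r X -> fdot X X = r%:R.
Proof.
move=> CX; have [_ [symX _] idX] := CX.
by rewrite /fdot symX idX (rank_projection_trace CX).
Qed.

Lemma nearest_maximizes r Z X Y :
  is_nearest (rank_projections r) Z X -> rank_projections r Y ->
  fdot Y Z <= fdot X Z.
Proof.
move=> [CX minX] CY; have := minX Y CY.
rewrite /frob_norm ler_sqrt ?fdot_ge0 // !mxinnerE !fdot_linE.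
rewrite (rank_projection_fdot CX) (rank_projection_fdot CY) !(fdotC Z).
lra.
Qed.

(** * First-order optimality of nearest points *)

Lemma eq0_of_le_square (q k : R) : (forall t, q * t <= k * t ^+ 2) -> q = 0.
Proof.
move=> h; apply/eqP; rewrite -sqrf_eq0 eq_le sqr_ge0 andbT.
have kpos : 0 < `|k| + 1 by rewrite ltr_wpDl.
(* At this [t] the hypothesis, cleared of denominators, reads [q^2 (|k| + 1) <= k q^2], which forces
   [q = 0]. *)
have := h (q / (`|k| + 1)); rewrite expr_div_n !mulrA ler_pdivlMr ?exprn_gt0 //.
rewrite (_ : q * q / (`|k| + 1) * (`|k| + 1) ^+ 2 = q ^+ 2 * (`|k| + 1)); last first.
  by field; rewrite gt_eqF.
have := ler_norm k; have := sqr_ge0 q; nra.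
Qed.

(** The line of [u] in the range of [X] is replaced by the line of [w]. Since [w - u] lies in the
    kernel of [X], the new line is orthogonal to the rest of the range, so the sum is again an
    orthogonal projection, of unchanged trace. *)
Lemma swap_direction_rank_projection r X u w :
  rank_projections r X -> X *m u = u -> X *m w = u -> fdot u u != 0 ->
  fdot u w = fdot u u -> fdot w w != 0 ->
  rank_projections r (X - (fdot u u)^-1 *: (u *m u^T) + (fdot w w)^-1 *: (w *m w^T)).
Proof.
move=> CX Xu Xw u0 uw w0; have [_ [symX _] idX] := CX.
have symdyad (v : 'cV[R]_n) : (v *m v^T)^T = v *m v^T by rewrite trmx_mul trmxK.
pose E := (fdot u u)^-1 *: (u *m u^T); pose F := (fdot w w)^-1 *: (w *m w^T).
have symE : E^T = E by rewrite linearZ /= symdyad.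
have symF : F^T = F by rewrite linearZ /= symdyad.
have trdyad (v : 'cV[R]_n) : fdot v v != 0 -> \tr ((fdot v v)^-1 *: (v *m v^T)) = 1.
  by move=> v0; rewrite linearZ /= mxtrace_mulC -/(fdot v v) mulVf.
have XE : X *m E = E by rewrite -scalemxAr mulmxA Xu.
have EX : E *m X = E by rewrite -[LHS]trmxK trmx_mul symX symE XE.
have Ew : E *m w = u.
  by rewrite -scalemxAl -mulmxA mul_tr_colE uw mul_mx_scalar scalerA mulVf ?scale1r.
have EE : E *m E = E.
  rewrite {2}/E -scalemxAr mulmxA -scalemxAl -mulmxA mul_tr_colE.
  by rewrite mul_mx_scalar scalerA mulVf ?scale1r.
have FF : F *m F = F.
  rewrite {2}/F -scalemxAr mulmxA -scalemxAl -mulmxA mul_tr_colE.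
  by rewrite mul_mx_scalar scalerA mulVf ?scale1r.
(* Both [X] and [E] send [w] to [u]; this kills the cross terms in the square of the sum. *)
have XF : (X - E) *m F = 0.
  by rewrite -scalemxAr mulmxA mulmxBl Xw Ew subrr mul0mx scaler0.
have FX : F *m (X - E) = 0.
  by rewrite -[LHS]trmxK trmx_mul symF raddfB /= symX symE XF trmx0.
rewrite -/E -/F; apply: mem_rank_projections.
- by rewrite raddfD raddfB /= symX symE symF.
- rewrite mulmxDl !(mulmxDr _ _ F) XF FX addr0 add0r FF; congr (_ + _).
  by rewrite mulmxBl !mulmxBr idX XE EX EE subrr subr0.
by rewrite raddfD raddfB /= !trdyad // subrK (rank_projection_trace CX).
Qed.

Lemma nearest_stationary_vector r Z X u v :
  is_nearest (rank_projections r) Z X -> X *m u = u -> X *m v = 0 ->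
  fdot u ((Z + Z^T) *m v) = 0.
Proof.
move=> nearX Xu Xv; have [CX _] := nearX; have [_ [symX _] idX] := CX.
have [u0|u0] := eqVneq (fdot u u) 0.
  by rewrite (fdot_eq0 u0) /fdot trmx0 mul0mx raddf0.
have upos : 0 < fdot u u by rewrite lt_def u0 fdot_ge0.
have uv : fdot u v = 0.
  by rewrite -Xu fdot_mull symX Xv /fdot mulmx0 raddf0.
pose q := fdot u ((Z + Z^T) *m v).
have fdot_tr (x y : 'cV[R]_n) : fdot x (Z^T *m y) = fdot y (Z *m x).
  by rewrite fdotC fdot_mull trmxK.
suff : fdot u u * q = 0 by move/eqP; rewrite mulf_eq0 (negPf u0) => /eqP.
(* With [w = u + t v], optimality says that the Rayleigh quotient of [Z] at [w] is at most the one
   at [u]. Clearing denominators leaves [|u|^2 q t] against this constant times [t^2]. *)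
apply: (@eq0_of_le_square _ (fdot v v * fdot u (Z *m u) - fdot u u * fdot v (Z *m v))).
move=> t; have [w wE] : exists w : 'cV[R]_n, w = u + t *: v by eexists.
have ww : fdot w w = fdot u u + t ^+ 2 * fdot v v.
  by rewrite wE !fdot_linE (fdotC v u) uv; ring.
have wpos : 0 < fdot w w.
  by rewrite ww; have := mulr_ge0 (sqr_ge0 t) (fdot_ge0 v); lra.
have Xw : X *m w = u by rewrite wE mulmxDr -scalemxAr Xu Xv scaler0 addr0.
have uw : fdot u w = fdot u u by rewrite wE fdotDr fdotZr uv mulr0 addr0.
have wZw : fdot w (Z *m w) =
    fdot u (Z *m u) + t * q + t ^+ 2 * fdot v (Z *m v).
  rewrite /q mulmxDl fdotDr fdot_tr wE mulmxDr -scalemxAr !fdot_linE; ring.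
have := nearest_maximizes nearX
  (swap_direction_rank_projection CX Xu Xw u0 uw (lt0r_neq0 wpos)).
rewrite !fdot_linE !(fdot_mulr _ _^T) !trmxK => swap_le.
have : (fdot w w)^-1 * fdot w (Z *m w) <= (fdot u u)^-1 * fdot u (Z *m u) by lra.
rewrite ler_pdivrMl // mulrCA ler_pdivlMl // wZw ww.
lra.
Qed.

Lemma nearest_stationary r Z X :
  is_nearest (rank_projections r) Z X ->
  X *m (Z + Z^T) *m (1%:M - X) = 0.
Proof.
move=> nearX; have [[_ [symX _] idX] _] := nearX.
apply/matrixP => i j; rewrite [RHS]mxE.
rewrite -(nearest_stationary_vector (u := col i X) (v := col j (1%:M - X)) nearX).
- rewrite /fdot trace_mx11 tr_col symX mulmxA -row_mul.
  by rewrite !mxE; apply: eq_bigr => k _; rewrite !mxE.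
- by rewrite colE mulmxA idX.
- by rewrite colE mulmxA mulmxBr mulmx1 idX subrr mul0mx.
Qed.

(** * The concavity inequality *)

Lemma fdot_quadratic_le W (k : R) (M : 'M[R]_n) :
  (forall v, `|fdot v (W *m v)| <= k * fdot v v) ->
  `|fdot M (W *m M)| <= k * fdot M M.
Proof.
move=> Wk; rewrite !fdot_colE mulr_sumr (le_trans (ler_norm_sum _ _ _)) //.
apply: ler_sum => j _; have -> : col j (W *m M) = W *m col j M.
  by rewrite !colE mulmxA.
exact: Wk.
Qed.

(* Stationarity leaves only the diagonal blocks of Y - X relative to the
   splitting range X + ker X, namely - X (1 - Y) X and (1 - X) Y (1 - X). Up to
   sign they are semidefinite of trace r - <X, Y> = |Y - X|^2 / 2. *)
Lemma nearest_inner_le r Z X Y (k : R) :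
  is_nearest (rank_projections r) Z X -> rank_projections r Y ->
  (forall v, `|fdot v ((Z - X) *m v)| <= k * fdot v v) ->
  fdot (Y - X) (Z - X) <= k * fdot (Y - X) (Y - X).
Proof.
move=> nearX CY Wk; have stat := nearest_stationary nearX.
have [CX _] := nearX; have [_ [symX _] idX] := CX; have [_ [symY _] idY] := CY.
have [W WE] : exists W : 'M[R]_n, W = Z - X by eexists.
have [X' X'E] : exists X' : 'M[R]_n, X' = 1%:M - X by eexists.
have [Y' Y'E] : exists Y' : 'M[R]_n, Y' = 1%:M - Y by eexists.
have [D DE] : exists D : 'M[R]_n, D = Y - X by eexists.
rewrite -WE -X'E -DE in Wk stat *.
have symX' : X'^T = X' by rewrite X'E raddfB /= trmx1 symX.
have symY' : Y'^T = Y' by rewrite Y'E raddfB /= trmx1 symY.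
have symD : D^T = D by rewrite DE raddfB /= symX symY.
have idX' : X' *m X' = X'.
  by rewrite X'E mulmxBl !mulmxBr !mulmx1 mul1mx idX subrr subr0.
have idY' : Y' *m Y' = Y'.
  by rewrite Y'E mulmxBl !mulmxBr !mulmx1 mul1mx idY subrr subr0.
have XX' : X *m X' = 0 by rewrite X'E mulmxBr mulmx1 idX subrr.
have X'X : X' *m X = 0 by rewrite X'E mulmxBl mul1mx idX subrr.
have [S SE] : exists S : 'M[R]_n, S = W + W^T by eexists.
have symS : S^T = S by rewrite SE raddfD /= trmxK addrC.
have XSX' : X *m S *m X' = 0.
  (* Stationarity concerns [Z + Z^T]; subtracting [X] twice does not affect the off-diagonal block,
     since [X X' = 0]. *)
  have -> : S = Z + Z^T - X - X.
    by rewrite SE WE raddfB /= symX addrACA addrA.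
  by rewrite !mulmxBr idX !mulmxBl stat XX' !subr0.
have X'SX : X' *m S *m X = 0.
  by apply: trmx_inj; rewrite !trmx_mul symX symX' symS mulmxA XSX' trmx0.
have defS : S = X *m S *m X + X' *m S *m X'.
  have {1}-> : S = (X + X') *m S *m (X + X').
    by rewrite X'E addrC subrK mul1mx mulmx1.
  by rewrite !mulmxDl !mulmxDr XSX' X'SX addr0 add0r.
have XDX : X *m D *m X = - ((X *m Y') *m (X *m Y')^T).
  rewrite trmx_mul symX symY' !mulmxA -(mulmxA X Y') idY' DE Y'E.
  by rewrite !mulmxBr !mulmxBl mulmx1 !idX opprB.
have X'DX' : X' *m D *m X' = (X' *m Y) *m (X' *m Y)^T.
  rewrite trmx_mul symX' symY !mulmxA -(mulmxA X' Y) idY DE.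
  by rewrite !mulmxBr X'X subr0.
have fdotS (M : 'M[R]_n) : fdot (M *m M^T) S = 2 * fdot M (W *m M).
  rewrite fdot_mulr trmxK SE mulmxDl fdotDr -[X in _ + X]fdot_mull.
  by rewrite (fdotC (W *m M)); ring.
(* As [D] is symmetric, only the symmetric part [S / 2] of [W] is seen, and [S] is block
   diagonal. *)
have DW : fdot D W = fdot (X' *m Y) (W *m (X' *m Y)) - fdot (X *m Y') (W *m (X *m Y')).
  have : 2 * fdot D W = fdot D S.
    rewrite SE fdotDr (_ : fdot D W^T = fdot D W); first by ring.
    by rewrite /fdot -mxtrace_tr trmx_mul !trmxK symD mxtrace_mulC.
  rewrite defS fdotDr.
  have -> : fdot D (X *m S *m X) = fdot (X *m D *m X) S.
    by rewrite [RHS]fdot_mulr [RHS]fdot_mull !symX mulmxA.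
  have -> : fdot D (X' *m S *m X') = fdot (X' *m D *m X') S.
    by rewrite [RHS]fdot_mulr [RHS]fdot_mull !symX' mulmxA.
  by rewrite XDX X'DX' fdotNl !fdotS; lra.
have trX := rank_projection_trace CX; have trY := rank_projection_trace CY.
have n1 : fdot (X' *m Y) (X' *m Y) = r%:R - fdot X Y.
  rewrite fdot_mull symX' mulmxA idX' X'E mulmxBl mul1mx /fdot symX symY.
  by rewrite mulmxBr raddfB /= idY trY mxtrace_mulC -mulmxA idY.
have n2 : fdot (X *m Y') (X *m Y') = r%:R - fdot X Y.
  rewrite fdot_mulr symY' -mulmxA idY' Y'E mulmxBr mulmx1 /fdot symX.
  by rewrite mulmxBr raddfB /= mulmxA idX trX.
have DD : fdot D D = 2 * (r%:R - fdot X Y).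
  rewrite DE !fdot_linE (rank_projection_fdot CX) (rank_projection_fdot CY).
  by rewrite (fdotC Y X); ring.
have := fdot_quadratic_le (X' *m Y) Wk.
have := fdot_quadratic_le (X *m Y') Wk.
(* Each block contributes at most [k (r - <X, Y>)]; the two together give [k |D|^2]. *)
rewrite !ler_norml => /andP[h1 _] /andP[_ h2].
by rewrite DW DD; rewrite n1 in h2; rewrite n2 in h1; lra.
Qed.

Lemma nearest_inner_le_sp_norm r Z X Y :
  is_nearest (rank_projections r) Z X -> rank_projections r Y ->
  fdot (Y - X) (Z - X) <= sp_norm (Z - X) * fdot (Y - X) (Y - X).
Proof.
by move=> nearX CY; apply: nearest_inner_le nearX CY _ => v; apply: quadratic_form_le_sp_norm.
Qed.

(** * Lipschitz dependence of nearest points, and nondegeneracy *)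

Lemma quadratic_form_le_fdot W v (k : R) :
  0 <= k -> fdot W W <= k ^+ 2 -> `|fdot v (W *m v)| <= k * fdot v v.
Proof.
move=> k0 Wk; rewrite -(@ler_pXn2r _ 2) ?nnegrE ?mulr_ge0 ?fdot_ge0 //.
(* The form equals [<W, v v^T>], and [v v^T] has Frobenius norm [|v|^2]. *)
rewrite real_normK ?num_real // fdotC fdot_mulr.
apply: le_trans (fdot_CauchySchwarz _ _) _.
rewrite [X in _ * X <= _]fdot_mulr trmxK -mulmxA mul_tr_colE mul_mx_scalar fdotZr.
by rewrite exprMn [X in _ <= _ * X]expr2 ler_wpM2r ?mulr_ge0 ?fdot_ge0.
Qed.

(** Equal norms give [<Y - X, X> = - |Y - X|^2 / 2]. The concavity inequality with constant 1/4
    consumes half of this, leaving a margin of 1/4. *)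
Lemma nearest_strong_maximizer r Z X Y :
  is_nearest (rank_projections r) Z X -> rank_projections r Y ->
  fdot (Z - X) (Z - X) <= (4^-1) ^+ 2 ->
  4^-1 * fdot (Y - X) (Y - X) <= fdot (X - Y) Z.
Proof.
move=> nearX CY ZX; have [CX _] := nearX.
have k0 : 0 <= 4^-1 :> R by rewrite invr_ge0.
have := nearest_inner_le nearX CY (fun v => quadratic_form_le_fdot v k0 ZX).
rewrite !fdot_linE (rank_projection_fdot CX) (rank_projection_fdot CY) (fdotC X Y).
lra.
Qed.

(* Below distance 1/4 the concavity inequality applied to both nearest points
   is a strong monotonicity estimate, which makes nearest points Lipschitz. *)
Lemma nearest_Lipschitz r X Z1 Z2 Q1 Q2 :
  rank_projections r X ->
  fdot (X - Z1) (X - Z1) <= (4^-1) ^+ 2 -> fdot (X - Z2) (X - Z2) <= (4^-1) ^+ 2 ->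
  is_nearest (rank_projections r) Z1 Q1 -> is_nearest (rank_projections r) Z2 Q2 ->
  fdot (Q1 - Q2) (Q1 - Q2) <= 2 ^+ 2 * fdot (Z1 - Z2) (Z1 - Z2).
Proof.
move=> CX XZ1 XZ2 near1 near2; have [C1 min1] := near1; have [C2 min2] := near2.
(* A nearest point [Q] is no farther from [Z] than [X] is. *)
have close Z Q : is_nearest (rank_projections r) Z Q ->
    fdot (X - Z) (X - Z) <= (4^-1) ^+ 2 -> fdot (Z - Q) (Z - Q) <= (4^-1) ^+ 2.
  move=> [_ /(_ X CX)]; rewrite /frob_norm ler_sqrt ?fdot_ge0 // !mxinnerE => h.
  by apply: le_trans; rewrite -opprB fdotNl fdotNr opprK.
have h1 := nearest_strong_maximizer near1 C2 (close _ _ near1 XZ1).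
have h2 := nearest_strong_maximizer near2 C1 (close _ _ near2 XZ2).
have [D DE] : exists D : 'M[R]_n, D = Q1 - Q2 by eexists.
have [E EE] : exists E : 'M[R]_n, E = Z1 - Z2 by eexists.
(* Sum of the two margins; Cauchy-Schwarz then yields the Lipschitz constant 2. *)
have DD : 2^-1 * fdot D D <= fdot D E.
  rewrite -opprB fdotNl fdotNr opprK in h1; rewrite -(opprB Q1) in h2.
  by rewrite DE EE fdotDr fdotNr; rewrite fdotNl in h2; lra.
rewrite -DE -EE; have := fdot_CauchySchwarz D E; have := fdot_ge0 D.
have := fdot_ge0 E.
have [->|D0] := eqVneq (fdot D D) 0; first by move=> *; rewrite mulr_ge0 ?sqr_ge0.
move=> Ege0 Dge0 CS; have Dpos : 0 < fdot D D by rewrite lt_def D0.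
rewrite -(ler_pM2l Dpos); nra.
Qed.

Lemma nbhs_fdot_le X (e : R) : 0 < e ->
  nbhs X [set Z | fdot (X - Z) (X - Z) <= e ^+ 2]%classic.
Proof.
(* The [n^2] squared entries then sum to at most [e^2]; the successor keeps the radius meaningful
   when [n = 0]. *)
move=> e0; apply/nbhs_ballP; exists (e / n.+1%:R); first by rewrite /= divr_gt0.
move=> Z /= [_ XZ]; rewrite fdotE.
have entry_le i j : (X - Z) i j * (X - Z) i j <= (e / n.+1%:R) ^+ 2.
  have := XZ i j; rewrite /ball /= !mxE => /ltW.
  rewrite -(@ler_pXn2r _ 2) ?nnegrE ?divr_ge0 ?(ltW e0) //.
  by rewrite real_normK ?num_real // expr2.
apply: (@le_trans _ _ (\sum_(i < n) \sum_(j < n) (e / n.+1%:R) ^+ 2)).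
  by do 2![apply: ler_sum => ? _].
rewrite !sumr_const !card_ord -mulrnA -[leLHS]mulr_natr expr_div_n.
rewrite [leLHS]mulrAC ler_pdivrMr ?exprn_gt0 //.
by rewrite ler_wpM2l ?sqr_ge0 // -natrX ler_nat mulnn leq_sqr.
Qed.

(** The Lipschitz estimate holds for arbitrary nearest points, so every choice [P] is continuous on
    the Frobenius ball of radius 1/4 around [X]. *)
Lemma nearest_point_not_degenerate r P X :
  projection_map (rank_projections r) P -> ~ degenerate (rank_projections r) P X.
Proof.
move=> nearP [CX]; apply.
exists [set Z | fdot (X - Z) (X - Z) <= (4^-1) ^+ 2]%classic.
split; first by apply: nbhs_fdot_le; rewrite invr_gt0.
apply/subspace_continuousP => Z XZ; apply/cvg_ballP => e e0.
(* The Lipschitz constant 2 turns [e / 4] into [e / 2], strictly below [e]. *)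
rewrite near_withinE; have e4 : 0 < e / 4 by rewrite divr_gt0.
apply: filterS (nbhs_fdot_le Z e4) => Z' ZZ' XZ'.
split=> // i j; rewrite /ball /=.
rewrite -(@ltr_pXn2r _ 2) ?nnegrE ?(ltW e0) // real_normK ?num_real //.
have -> : P Z i j - P Z' i j = (P Z - P Z') i j by rewrite !mxE.
apply: le_lt_trans (sqr_entry_le _ _ _) _.
apply: le_lt_trans (nearest_Lipschitz CX XZ XZ' (nearP Z) (nearP Z')) _.
apply: (@le_lt_trans _ _ (2 ^+ 2 * (e / 4) ^+ 2)); first by rewrite ler_wpM2l ?sqr_ge0.
have : 0 < e ^+ 2 by rewrite exprn_gt0.
rewrite expr_div_n; lra.
Qed.

End RankProjections.

Theorem lemma12 (R : realType) (n r : nat) (hr : (1 <= r)%N) (hrn : (r <= n)%N) :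
  (forall Z : 'M[R]_n, dual_norm nuc_norm Z = sp_norm Z) /\
  (forall P : 'M[R]_n -> 'M[R]_n, projection_map (rank_projections r) P ->
   forall X : 'M[R]_n, rank_projections r X ->
     (local_concavity nuc_norm (rank_projections r) P X <= 2%:E)%E).
Proof.
split=> [|P nearP X CX]; first exact: dual_nuc_norm.
rewrite /local_concavity asboolF; last exact: nearest_point_not_degenerate.
apply: ereal_inf_lbound; split=> [|Y Z CY nearX]; first by rewrite lee_fin.
rewrite -EFinM lee_fin dual_nuc_norm /frob_norm sqr_sqrtr ?fdot_ge0 // !mxinnerE.
(* The inequality holds with coefficient 1, which is then relaxed to 2. *)
apply: le_trans (nearest_inner_le_sp_norm nearX CY) _.
by rewrite ler_peMl ?mulr_ge0 ?sp_norm_ge0 ?fdot_ge0 ?ler1n.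
Qed.
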